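(* Let $G$ be a connected graph. Then $\operatorname{sgon}(G)\geq\operatorname{tw}(G)$, where $\operatorname{sgon}(G)$ is the stable gonality of $G$, i.e. the minimum degree of an indexed harmonic homomorphism from a refinement of $G$ to a tree.
   Context: Graphs are finite, undirected and connected; parallel edges are allowed, loops are not. $E(u,v)$ is the set of edges between $u$ and $v$, and $E(v)$ the set of edges with $v$ as an end. A refinement of $G$ is a graph obtained from $G$ by (repeatedly) subdividing edges and adding leaves (vertices of degree 1). A homomorphism from $G=(V,E)$ to $G'=(V',E')$ is a map $\phi:V\cup E\to V'\cup E'$ with $\phi(V)\subseteq V'$, $\phi(E)\subseteq E'$, and $\phi(e)\in E'(\phi(u),\phi(v))$ whenever $e\in E(u,v)$. An indexed harmonic homomorphism is a homomorphism $\phi$ together with a positive integer $r_e$ for every edge $e\in E$, such that for every $v\in V$ there is a nonnegative integer $m_\phi(v)$ with $$m_\phi(v)=\sum_{e\in\phi^{-1}(e')\cap E(v)}r_e\quad\text{for every } e'\in E'(\phi(v)).$$ Its degree $\deg(\phi)$ is the number such that $\deg(\phi)=\sum_{e\in\phi^{-1}(e')}r_e=\sum_{v\in\phi^{-1}(v')}m_\phi(v)$ for every $e'\in E'$ and every $v'\in V'$ (it is independent of $e'$ and $v'$). The target trees and the refinements considered have at least one edge, so the degree is well defined. A (simple) graph $H$ is chordal if it has no induced cycle of length at least $4$. A chordal extension of $G=(V,E)$ is a chordal graph $H$ on the same vertex set $V$ in which any two vertices adjacent in $G$ are adjacent. With $\omega(H)$ the maximum size of a clique in $H$, the treewidth is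 $\operatorname{tw}(G)=-1+\min\{\omega(H) : H \text{ is a chordal extension of } G\}$. *)

(* Defs.v *)
From mathcomp Require Import all_boot all_order all_algebra.
From mathcomp Require Import boolp.
Set Implicit Arguments.
Unset Strict Implicit.
Unset Printing Implicit Defensive.

(* Finite undirected multigraphs: parallel edges are allowed, and loops are
   excluded because every edge has exactly two ends. *)
Record mgraph := MGraph {
  vertex : finType;
  edge : finType;
  ends : edge -> {set vertex};
  card_ends : forall e, #|ends e| == 2 }.

Definition edges_between (G : mgraph) (u v : vertex G) : {set edge G} :=
  [set e | ends e == [set u; v]].

Definition edges_at (G : mgraph) (v : vertex G) : {set edge G} :=
  [set e | v \in ends e].

Definition adjacent (G : mgraph) : rel (vertex G) :=
  fun u v => edges_between u v != set0.

Definition connected_graph (G : mgraph) : bool :=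
  (0 < #|vertex G|) && [forall u, forall v, connect (@adjacent G) u v].

(* A cycle of length k >= 2 has distinct vertices and distinct edges (two
   parallel edges form a cycle of length 2); [ordS] is the successor mod k. *)
Definition has_cycle (G : mgraph) : Prop :=
  exists (k : nat) (v : 'I_k -> vertex G) (e : 'I_k -> edge G),
    [/\ 1 < k, injective v, injective e
      & forall i, e i \in edges_between (v i) (v (ordS i))].

Definition is_tree (T : mgraph) : Prop := connected_graph T /\ ~ has_cycle T.

Definition mgraph_iso (G H : mgraph) : Prop :=
  exists (f : vertex G -> vertex H) (g : edge G -> edge H),
    [/\ bijective f, bijective g & forall e, ends (g e) = f @: ends e].

Section AddLeaf.
Variables (G : mgraph) (u : vertex G).

(* The new vertex and the new edge are both [None]. *)
Definition leaf_ends (o : option (edge G)) : {set option (vertex G)} :=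
  if o is Some f then Some @: ends f else [set None; Some u].

Lemma leaf_card_ends o : #|leaf_ends o| == 2.
Proof.
case: o => [f|] /=; last by rewrite cards2.
by rewrite card_imset ?card_ends //; apply: Some_inj.
Qed.

Definition add_leaf : mgraph := MGraph leaf_card_ends.
End AddLeaf.

Section Subdivide.
Variables (G : mgraph) (e : edge G) (u : vertex G) (ue : u \in ends e).

(* The edge e with ends u, v is replaced by the edges [None] between the new
   vertex [None] and u, and [Some e] between the new vertex and v. *)
Definition subdivide_ends (o : option (edge G)) : {set option (vertex G)} :=
  if o is Some f then
    if f == e then None |: (Some @: (ends e :\ u)) else Some @: ends f
  else [set None; Some u].

Lemma subdivide_card_ends o : #|subdivide_ends o| == 2.
Proof.
case: o => [f|] /=; last by rewrite cards2.
have Sinj : injective (@Some (vertex G)) by apply: Some_inj.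
case: (f == e); last by rewrite card_imset ?card_ends.
rewrite cardsU1 card_imset //.
have -> : None \notin Some @: (ends e :\ u) by apply/imsetP => -[].
by have := card_ends e; rewrite (cardsD1 u) ue.
Qed.

Definition subdivide : mgraph := MGraph subdivide_card_ends.
End Subdivide.

Inductive refinement (G : mgraph) : mgraph -> Prop :=
| refinement_refl : refinement G G
| refinement_subdivide (H : mgraph) (e : edge H) (u : vertex H)
    (ue : u \in ends e) : refinement G H -> refinement G (subdivide ue)
| refinement_leaf (H : mgraph) (u : vertex H) :
    refinement G H -> refinement G (add_leaf u)
| refinement_iso (H H' : mgraph) :
    refinement G H -> mgraph_iso H H' -> refinement G H'.

Record indexed_harmonic (G G' : mgraph) := IndexedHarmonic {
  hom_vertex : vertex G -> vertex G';
  hom_edge : edge G -> edge G';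
  hom_index : edge G -> nat;
  hom_mult : vertex G -> nat;
  hom_edges_between : forall u v e, e \in edges_between u v ->
    hom_edge e \in edges_between (hom_vertex u) (hom_vertex v);
  hom_index_gt0 : forall e, 0 < hom_index e;
  hom_harmonic : forall v e', e' \in edges_at (hom_vertex v) ->
    hom_mult v = \sum_(e in edges_at v | hom_edge e == e') hom_index e }.

(* [has_degree phi d] reads "phi has degree d". When G' has an edge there is at
   most one such d, and when G' is moreover connected there is exactly one. *)
Definition has_degree (G G' : mgraph) (phi : indexed_harmonic G G') (d : nat) :
    Prop :=
  (forall e' : edge G',
     d = \sum_(e | hom_edge phi e == e') hom_index phi e) /\
  (forall v' : vertex G',
     d = \sum_(v | hom_vertex phi v == v') hom_mult phi v).

Definition sgon_attained (G : mgraph) (d : nat) : Prop :=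
  exists (H T : mgraph) (phi : indexed_harmonic H T),
    [/\ refinement G H /\ 0 < #|edge H|, is_tree T /\ 0 < #|edge T|
      & has_degree phi d].

(* The minimum defining stable gonality ranges over a nonempty set: subdividing
   edges (after adding a leaf if there is no edge) yields a bipartite
   refinement, which maps harmonically, with all indices 1, to the tree with a
   single edge. *)
Definition K2 : mgraph :=
  @MGraph bool unit (fun=> [set: bool])
    (fun=> introT eqP (etrans (cardsT bool) card_bool)).

Lemma K2_edges (u v : vertex K2) (e : edge K2) :
  (e \in edges_between u v) = (u != v).
Proof.
rewrite inE eq_sym eqEcard subsetT cardsT card_bool cards2.
by case: (u != v).
Qed.

Lemma K2_tree : is_tree K2.
Proof.
split.
  rewrite /connected_graph /= card_bool /=; apply/forallP=> u; apply/forallP=> v.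
  have [->|neq] := eqVneq u v; first exact: connect0.
  by apply: connect1; apply/set0Pn; exists (tt : edge K2); rewrite K2_edges.
move=> [k [v [e [k1 _ einj _]]]].
by have := leq_card e einj; rewrite card_ord card_unit leqNgt k1.
Qed.

Section Bipartite.
Variables (H : mgraph) (c : vertex H -> bool).
Hypothesis cH : forall (u v : vertex H) e, e \in edges_between u v -> c u != c v.

Let K2_edges_between (u v : vertex H) (e : edge H) :
  e \in edges_between u v -> (tt : edge K2) \in edges_between (c u : vertex K2) (c v).
Proof. by rewrite K2_edges; apply: cH. Qed.

Let K2_harmonic (v : vertex H) (e' : edge K2) :
  e' \in edges_at (c v : vertex K2) ->
  #|edges_at v| = \sum_(e in edges_at v | (tt : edge K2) == e') 1.
Proof.
move=> _; case: e'; rewrite sum1_card; apply: eq_card => e.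
by rewrite [RHS]unfold_in /= andbT.
Qed.

Definition K2_hom : indexed_harmonic H K2 :=
  @IndexedHarmonic H K2 c (fun=> tt) (fun=> 1) (fun v => #|edges_at v|)
    K2_edges_between (fun=> isT) K2_harmonic.

Lemma K2_hom_degree : has_degree K2_hom #|edge H|.
Proof.
split=> [[]|b] /=; first by rewrite sum1_card; apply: eq_card.
transitivity (\sum_(v | c v == b) \sum_(e | v \in ends e) 1); last first.
  apply: eq_bigr => v _; rewrite sum1_card; apply: eq_card => e.
  by rewrite inE.
rewrite (exchange_big_dep predT) //= -sum1_card.
apply: eq_bigr => e _.
have /cards2P[u [v [uv euv]]] := card_ends e.
have /cH cuv : e \in edges_between u v by rewrite inE euv.
have [w wP] : exists w, forall x, (c x == b) && (x \in ends e) = (x == w).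
  have [bu|bu] := eqVneq (c u) b; [exists u|exists v] => x; rewrite euv !inE.
    have [->|_] := eqVneq x u; first by rewrite bu eqxx.
    have [->|_] := eqVneq x v; last by rewrite andbF.
    by rewrite andbT -bu eq_sym (negPf cuv).
  have [->|_] := eqVneq x v.
    by rewrite orbT andbT; case: (c u) (c v) (b) bu cuv => -[] [].
  rewrite orbF; have [->|_] := eqVneq x u; last by rewrite andbF.
  by rewrite (negPf bu).
by rewrite (eq_bigl _ _ wP) big_pred1_eq.
Qed.

End Bipartite.

Definition monochromatic (H : mgraph) (c : vertex H -> bool) : {set edge H} :=
  [set e | [exists u, exists v, (ends e == [set u; v]) && (c u == c v)]].

Lemma bipartite_refinement (G H : mgraph) (c : vertex H -> bool) :
  refinement G H -> 0 < #|edge H| ->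
  exists (H' : mgraph) (c' : vertex H' -> bool),
    [/\ refinement G H', 0 < #|edge H'| & monochromatic c' = set0].
Proof.
have [n] := ubnP #|monochromatic c|; elim: n H c => // n IHn H c ltn GH H0.
have [M0|/set0Pn[e eM]] := eqVneq (monochromatic c) set0; first by exists H, c.
move: (eM); rewrite inE => /existsP[u /existsP[v /andP[/eqP euv /eqP cuv]]].
have ue : u \in ends e by rewrite euv !inE eqxx.
pose c' (x : vertex (subdivide ue)) := oapp c (~~ c u) x.
apply: (IHn _ c'); [|exact: refinement_subdivide|by rewrite card_option].
apply: leq_trans (_ : #|monochromatic c| <= n); last by [].
rewrite [X in _ < X](cardsD1 e) eM ltnS.
have SI (T : Type) : injective (@Some T) by move=> ? ? [].
rewrite -(card_imset _ (SI (edge H))).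
apply/subset_leq_card/subsetP => f.
rewrite inE => /existsP[x /existsP[y /andP[/eqP fxy /eqP cxy]]].
have xf : x \in ends f by rewrite fxy !inE eqxx.
have yf : y \in ends f by rewrite fxy !inE eqxx orbT.
have xy : x != y by have := card_ends f; rewrite fxy cards2; case: (x != y).
have cc z : z \in ends e -> c z = c u by rewrite euv !inE => /orP[]/eqP->.
case: f fxy xf yf => [f|] /= fxy xf yf; last first.
  move: xf yf xy cxy; rewrite !inE => /orP[]/eqP-> /orP[]/eqP->; rewrite ?eqxx //= => _.
    by case: (c u).
  by case: (c u).
apply: imset_f; rewrite !inE; move: fxy xf yf; case: (eqVneq f e) => [_|fe] fxy.
  rewrite !inE => /orP[/eqP xN|/imsetP[x' + xS]] /orP[/eqP yN|/imsetP[y' + yS]]; subst.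
  - by rewrite eqxx in xy.
  - by rewrite !inE => /andP[_ /cc] /= cy; move: cxy; rewrite /= cy; case: (c u).
  - by rewrite !inE => /andP[_ /cc] /= cx; move: cxy; rewrite /= cx; case: (c u).
  rewrite euv !inE => /andP[/negPf-> /= /eqP x'v] /andP[/negPf-> /= /eqP y'v].
  by rewrite x'v y'v eqxx in xy.
move=> /imsetP[x' _ xS] /imsetP[y' _ yS]; subst.
apply/existsP; exists x'; apply/existsP; exists y'; move: cxy => /= ->; rewrite eqxx andbT.
by apply/eqP/(imset_inj (SI _)); rewrite fxy imsetU1 imset_set1.
Qed.

Lemma sgon_attained_ex (G : mgraph) :
  connected_graph G -> exists d, `[< sgon_attained G d >].
Proof.
move=> /andP[/card_gt0P[u _] _].
have [H GH H0] : exists2 H, refinement G H & 0 < #|edge H|.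
  exists (add_leaf u); last by rewrite card_option.
  exact/refinement_leaf/refinement_refl.
have [H' [c [GH' H'0 M0]]] := bipartite_refinement (fun=> true) GH H0.
have cH (x y : vertex H') e : e \in edges_between x y -> c x != c y.
  rewrite inE => exy; apply: contraT => /negPn cxy.
  have : e \in monochromatic c.
    by rewrite inE; apply/existsP; exists x; apply/existsP; exists y; rewrite exy.
  by rewrite M0 inE.
exists #|edge H'|; apply/asboolP; exists H', K2, (K2_hom cH).
split=> //; last exact: K2_hom_degree.
by split; [exact: K2_tree|rewrite card_unit].
Qed.

Definition sgon (G : mgraph) (hG : connected_graph G) : nat :=
  ex_minn (sgon_attained_ex hG).

(* A simple graph on the vertex set V is a symmetric irreflexive relation. *)
Definition clique_number (V : finType) (h : rel V) : nat :=
  \max_(K : {set V} | [forall u in K, forall v in K, (u != v) ==> h u v]) #|K|.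

Definition chordal (V : finType) (h : rel V) : Prop :=
  ~ exists (k : nat) (c : 'I_k -> V),
      [/\ 4 <= k, injective c
        & forall i j, h (c i) (c j) = (j == ordS i) || (i == ordS j)].

Definition chordal_extension (G : mgraph) (h : rel (vertex G)) : Prop :=
  [/\ symmetric h, irreflexive h, chordal h
    & forall u v, adjacent u v -> h u v].

Definition tw_attained (G : mgraph) (w : nat) : Prop :=
  exists2 h : rel (vertex G), chordal_extension h & clique_number h = w.

(* The complete graph is a chordal extension. *)
Lemma tw_attained_ex (G : mgraph) : exists w, `[< tw_attained G w >].
Proof.
pose h : rel (vertex G) := fun u v => u != v.
exists (clique_number h); apply/asboolP; exists h => //; split.
- by move=> u v; rewrite /h eq_sym.
- by move=> u; rewrite /h eqxx.
- case=> -[|[|[|[|k]]]] [c [//= _ cinj cE]].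
  have := cE ord0 (inord 2).
  by rewrite /h (inj_eq cinj) -!val_eqE /= inordK //= !modn_small.
- move=> u v /set0Pn[e]; rewrite inE => /eqP euv.
  by have := card_ends e; rewrite euv cards2 /h; case: (u != v).
Qed.

(* An integer, so that -1 is not truncated. *)
Definition treewidth (G : mgraph) : int :=
  (-1 + (ex_minn (tw_attained_ex G))%:Z)%R.

(* Main.v *)
Require Import Defs.
From mathcomp Require Import all_boot all_order all_algebra.
From mathcomp Require Import boolp zify.
Set Implicit Arguments.
Unset Strict Implicit.
Unset Printing Implicit Defensive.

(** A rooting of the tree T makes it a rooted tree decomposition of the refinement
    H: the bag of a vertex of T is its fibre, and along an edge of T the fibre of
    one end is traded for the fibre of the other, one edge of H at a time. Every
    fibre has at most d vertices and at most d edges, so the bags have at most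
    d + 1 vertices. Undoing the refinement steps only contracts edges, which
    carries the decomposition over to G. Making any two vertices of a common bag
    adjacent gives the chordal extension: in a clique or an induced cycle, the
    vertex whose subtree has the deepest root t shares the bag of t with all its
    neighbours. *)

(** * Edges, cycles and rootings of forests *)

Lemma ends_neq (G : mgraph) (e : edge G) (u v : vertex G) :
  ends e = [set u; v] -> u != v.
Proof. by move=> E; have := card_ends e; rewrite E cards2; case: (u != v). Qed.

Lemma ends_other (G : mgraph) (e : edge G) (u : vertex G) :
  u \in ends e -> exists v, ends e = [set u; v].
Proof.
have /cards2P[a [b [_ ->]]] := card_ends e.
rewrite !inE => /orP[]/eqP->; first by exists b.
by exists a; rewrite setUC.
Qed.

Lemma ends_common (G : mgraph) (e : edge G) (u v x y : vertex G) :
  ends e = [set u; v] -> ends e = [set x; y] ->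
  (u = x /\ v = y) \/ (u = y /\ v = x).
Proof.
move=> E1 E2; have uv := ends_neq E1.
have := set21 u v; have := set22 u v; rewrite -E1 E2 !inE.
case/orP=> /eqP vE /orP[]/eqP uE; subst; rewrite ?eqxx // in uv *; by [left|right].
Qed.

Lemma adjacent_sym (G : mgraph) : symmetric (@adjacent G).
Proof. by move=> u v; rewrite /adjacent /edges_between setUC. Qed.

(** Take the shortest return time [k] of the walk: the vertices are then distinct, and an edge
    occurring twice would give a shorter return or a backtrack. *)
Lemma nonbacktracking_cycle (G : mgraph) (v : nat -> vertex G)
    (e : nat -> edge G) :
  (forall i, ends (e i) = [set v i; v i.+1]) -> (forall i, e i != e i.+1) ->
  has_cycle G.
Proof.
move=> vE eN.
have vN i : v i != v i.+1 := ends_neq (vE i).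
have ex_g : exists g, `[< 0 < g /\ exists i, v (i + g) = v i >].
  have /injectivePn[i [j ij vij]] :
      ~~ injectiveb (fun i : 'I_#|vertex G|.+1 => v i).
    by apply/injectiveP => /leq_card; rewrite card_ord ltnn.
  wlog lt_ij : i j ij vij / i < j.
    move=> W; case: (ltngtP i j) => [|ji|/val_inj E]; first exact: (W i j).
      by apply: (W j i) => //; rewrite eq_sym.
    by rewrite E eqxx in ij.
  exists (j - i); apply/asboolP; split; first by rewrite subn_gt0.
  by exists i; rewrite subnKC // ltnW.
case: (ex_minnP ex_g) => k /asboolP[k0 [i vik]] kmin.
have dist a b : a < b -> v b = v a -> k <= b - a.
  move=> ab vab; apply: kmin; apply/asboolP; split; first by rewrite subn_gt0.
  by exists a; rewrite subnKC // ltnW.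
have k1 : 1 < k.
  case: k k0 vik {kmin dist} => [|[|k]] // _ E.
  by have := vN i; rewrite -addn1 E eqxx.
exists k, (fun m => v (i + m)), (fun m => e (i + m)); split => //.
- move=> a b /= E; apply/val_inj; have := ltn_ord a; have := ltn_ord b.
  by case: (ltngtP (a : nat) b) => // ab lb la;
    [have := dist (i + a) (i + b)|have := dist (i + b) (i + a)] => /(_ ltac:(lia) ltac:(by [])); lia.
- suff W (a b : nat) : a < b -> b < k -> e (i + a) = e (i + b) -> False.
    move=> a b /= E; apply/val_inj; have := ltn_ord a; have := ltn_ord b.
    case: (ltngtP (a : nat) b) => // ab lb la.
      by have := W a b ab lb E.
    by have := W b a ab la (esym E).
  move=> ab bk E; have Eb := vE (i + b); rewrite -E in Eb.
  case: (ends_common (vE (i + a)) Eb) => -[E1 E2].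
    by have := dist (i + a) (i + b) ltac:(lia) (esym E1); lia.
  have := dist (i + a) (i + b).+1 ltac:(lia) (esym E1) => kb.
  have [ab1|ab1] := ltnP a.+1 b.
    by have := dist (i + a).+1 (i + b) ltac:(lia) (esym E2); lia.
  have E3 : i + b = (i + a).+1 by lia.
  by have := eN (i + a); rewrite -E3 E eqxx.
- move=> m; rewrite inE vE -addnS /=; have := ltn_ord m.
  rewrite leq_eqVlt => /orP[/eqP->|mk]; last by rewrite modn_small.
  by rewrite modnn addn0 vik.
Qed.

(** Otherwise each vertex of [S] could be left by an edge other than the one by which it was
    entered, giving an endless walk in [S] without backtracking. *)
Lemma acyclic_leaf (T : mgraph) (S : {set vertex T}) :
  ~ has_cycle T -> S != set0 ->
  exists2 v, v \in S & forall e1 e2, v \in ends e1 -> ends e1 \subset S ->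
    v \in ends e2 -> ends e2 \subset S -> e1 = e2.
Proof.
move=> acT /set0Pn[v0 v0S]; apply: contrapT => noleaf; apply: acT.
have next v (oe : option (edge T)) : v \in S ->
    exists2 e, Some e != oe & v \in ends e /\ ends e \subset S.
  move=> vS; apply: contrapT => H; apply: noleaf; exists v => // e1 e2 v1 s1 v2 s2.
  have H' e : v \in ends e -> ends e \subset S -> Some e = oe.
    by move=> ve es; apply/eqP; apply: contrapT => /negP ne; apply: H; exists e.
  by apply: Some_inj; rewrite (H' e1) ?(H' e2).
(* A state is the current vertex with the edge just used, [None] at the start. *)
pose P (x y : vertex T * option (edge T)) := x.1 \in S ->
  exists e, [/\ y.2 = Some e, y.2 != x.2, ends e = [set x.1; y.1] & y.1 \in S].
have /choice[s sP] x : exists y, P x y.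
  case: (boolP (x.1 \in S)) => xS; last by exists x => /(negP xS).
  have [e eN [xe eS]] := next _ x.2 xS; have [w we] := ends_other xe.
  exists (w, Some e) => _; exists e; split => //.
  by apply: (subsetP eS); rewrite we set22.
pose x n := iter n s (v0, None).
have xS n : (x n).1 \in S.
  by elim: n => //= n IH; have [e []] := sP _ IH.
have /choice[e eP] n : exists e, [/\ (x n.+1).2 = Some e, (x n.+1).2 != (x n).2,
    ends e = [set (x n).1; (x n.+1).1] & (x n.+1).1 \in S] by exact: sP.
apply: (@nonbacktracking_cycle T (fun n => (x n).1) e) => i.
  by have [] := eP i.
have [E1 _ _ _] := eP i; have [E2 + _ _] := eP i.+1.
by rewrite E1 E2; apply: contraNneq => ->.
Qed.

(* Every edge of a forest joins [child e] to its parent: this rooting is all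
   that is used of the tree. *)
Lemma forest_rooting (T : mgraph) : ~ has_cycle T ->
  exists (child : edge T -> vertex T) (par : vertex T -> vertex T)
      (rk : vertex T -> nat),
    injective child /\ forall e, ends e = [set child e; par (child e)] /\
      rk (par (child e)) < rk (child e).
Proof.
move=> acT.
(* Induction on [S]: a leaf or isolated vertex [v] is removed, the rest is rooted, and [v] becomes
   the child end of its edge. *)
suff rooting (S : {set vertex T}) :
    exists (child : edge T -> vertex T) (par : vertex T -> vertex T)
      (rk : vertex T -> nat),
    {in [pred e | ends e \subset S] &, injective child} /\
    forall e, ends e \subset S -> ends e = [set child e; par (child e)] /\
      rk (par (child e)) < rk (child e).
  have [child [par [rk [cI cE]]]] := rooting setT.
  exists child, par, rk; split=> [e1 e2|e]; last by apply: cE; rewrite subsetT.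
  by apply: cI; rewrite inE subsetT.
have [n] := ubnP #|S|; elim: n S => // n IHn S leS.
have [S0|Sn0] := eqVneq S set0.
  have /choice[child _] (e : edge T) : exists v, v \in ends e.
    by apply/set0Pn; rewrite -card_gt0 (eqP (card_ends e)).
  have no e : ends e \subset S -> False.
    by move/subset_leq_card; rewrite S0 cards0 (eqP (card_ends e)).
  by exists child, id, (fun=> 0); split=> [e1 e2|e] /no.
have [v vS vleaf] := acyclic_leaf acT Sn0.
have [|child [par [rk [cI cE]]]] := IHn (S :\ v).
  by move: leS; rewrite (cardsD1 v S) vS.
(* [w] is the only neighbour of [v] in [S]; if there is none, any value serves. *)
have [w wP] : exists w, forall e, v \in ends e -> ends e \subset S ->
    ends e = [set v; w].
  have [[e [ve eS]]|no] := pselect (exists e, v \in ends e /\ ends e \subset S).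
    have [w we] := ends_other ve; exists w => e' ve' e'S.
    by rewrite (vleaf e' e).
  by exists v => e ve eS; case: no; exists e.
have subS e : v \notin ends e -> ends e \subset S -> ends e \subset S :\ v.
  by move=> ve eS; rewrite subsetD1 eS.
exists (fun e => if v \in ends e then v else child e),
  (fun t => if t == v then w else par t),
  (fun t => if t == v then (rk w).+1 else rk t).
have childN e : v \notin ends e -> ends e \subset S ->
    (child e == v = false) * (par (child e) == v = false).
  move=> ve eS; have [E _] := cE _ (subS _ ve eS).
  by split; apply: contraNF ve => /eqP <-; rewrite E !inE eqxx ?orbT.
split=> [e1 e2|e eS].
  rewrite !inE => s1 s2; case: ifPn => v1; case: ifPn => v2.
  - by move=> _; apply: vleaf.
  - by move/esym/eqP; rewrite childN.
  - by move/eqP; rewrite childN.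
  - by apply: cI; rewrite inE subS.
case: ifPn => ve.
  rewrite eqxx (wP e) //; split=> //.
  by have := ends_neq (wP e ve eS); rewrite eq_sym => /negPf ->.
by rewrite !(childN e) //; apply: cE; apply: subS.
Qed.

(** * Rooted tree decompositions and chordal extensions *)

(* A rooted tree (or forest) decomposition with bags of size at most w: the
   nodes whose bag contains v form a subtree with root [top v]. *)
Definition rooted_decomposition (V : finType) (e : rel V) (w : nat) : Prop :=
  exists (N : Type) (rank : N -> nat) (par : N -> N) (B : N -> {set V})
      (top : V -> N),
    [/\ forall v, v \in B (top v),
        forall v n, v \in B n -> n = top v \/
          (v \in B (par n) /\ rank (par n) < rank n),
        forall u v, e u v -> exists n, u \in B n /\ v \in B n
      & forall n, #|B n| <= w].

Section Subtrees.
Variables (V : finType) (N : Type) (rank : N -> nat) (par : N -> N).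
Variables (B : N -> {set V}) (top : V -> N).
Hypothesis parP : forall v n, v \in B n -> n = top v \/
  (v \in B (par n) /\ rank (par n) < rank n).

Lemma rank_top v n : v \in B n -> rank (top v) <= rank n.
Proof.
have [m] := ubnP (rank n); elim: m n => // m IH n lt_n vn.
have [->//|[vp lt_p]] := parP vn.
apply: leq_trans (ltnW lt_p); apply: IH => //; exact: leq_trans lt_p lt_n.
Qed.

(** Climb from [n] along the bags of [v]: [u] cannot drop out before [top v] is reached, because its
    own root is no deeper. *)
Lemma lower_top u v n : u \in B n -> v \in B n ->
  rank (top u) <= rank (top v) -> u \in B (top v).
Proof.
move=> + + uv; have [m] := ubnP (rank n); elim: m n => // m IH n lt_n un vn.
have [<-//|[vp lt_p]] := parP vn.
have [nu|[up _]] := parP un.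
  by move: lt_p (rank_top vp) uv; rewrite -nu; lia.
by apply: (IH (par n)) => //; apply: leq_trans lt_p lt_n.
Qed.

End Subtrees.

(** Used for a chord: [p] and [ordS (ordS p)] are the two neighbours of [ordS p] on a cycle. *)
Lemma ordS_iter_neq k (p : 'I_k) : 4 <= k ->
  [/\ ordS (ordS p) != p, p != ordS (ordS (ordS p)) & ordS (ordS p) != ordS p].
Proof.
move=> k4; have E (i : 'I_k) :
    (i.+1 < k /\ ordS i = i.+1 :> nat) \/ (i.+1 = k /\ ordS i = 0 :> nat).
  have := ltn_ord i; rewrite leq_eqVlt => /orP[/eqP ik|ik]; [right|left].
    by rewrite /= ik modnn.
  by rewrite /= modn_small.
rewrite -!val_eqE; have := E p; have := E (ordS p); have := E (ordS (ordS p)).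
move: (ordS p) (ordS (ordS p)) (ordS (ordS (ordS p))) => a b c /=.
by split; lia.
Qed.

Lemma decomposition_chordal (G : mgraph) (w : nat) :
  rooted_decomposition (@adjacent G) w ->
  exists2 h : rel (vertex G), chordal_extension h & clique_number h <= w.
Proof.
move=> [N [rank [par [B [top [topP parP adjP cardB]]]]]].
pose h (u v : vertex G) := (u != v) && `[< exists n, u \in B n /\ v \in B n >].
have hP u v : h u v -> rank (top u) <= rank (top v) -> u \in B (top v).
  by move=> /andP[_ /asboolP[n [un vn]]]; exact: (lower_top parP un vn).
have hsym : symmetric h.
  move=> u v; rewrite /h eq_sym; congr (_ && _).
  by apply: asbool_equiv_eq; split=> -[n [? ?]]; exists n.
exists h.
  split=> //.
  - by move=> u; rewrite /h eqxx.
  - move=> [[|k] [c [// k4 cI cE]]].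
    (* [c i] has the deepest root on the cycle, so both its neighbours lie in the bag of that root
       and are joined by a chord. *)
    pose i := [arg max_(i > ord0 : 'I_k.+1) rank (top (c i))].
    have imax j : rank (top (c j)) <= rank (top (c i)).
      by rewrite /i; case: arg_maxnP => // m _ mP; exact: mP.
    have := ordS_iter_neq (ord_pred i) k4; rewrite ord_predK => -[p1 p2 p3].
    have h1 : h (c (ordS i)) (c i) by rewrite cE eqxx orbT.
    have h2 : h (c (ord_pred i)) (c i) by rewrite cE ord_predK eqxx.
    have : h (c (ordS i)) (c (ord_pred i)).
      rewrite /h; apply/andP; split; last first.
        by apply/asboolP; exists (top (c i)); split; apply: hP.
      by rewrite (inj_eq cI).
    by rewrite cE ord_predK (negPf p2) (negPf p3).
  - move=> u v uv; apply/andP; split; last exact/asboolP/adjP.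
    by case/set0Pn: uv => e; rewrite inE => /eqP /ends_neq.
apply/bigmax_leqP => K /forallP Kc.
have [->|/set0Pn[v0 v0K]] := eqVneq K set0; first by rewrite cards0.
pose v := [arg max_(v > v0 in K) rank (top v)].
have [vK vmax] : v \in K /\ forall u, u \in K -> rank (top u) <= rank (top v).
  by rewrite /v; case: arg_maxnP => // m mK mP; split.
apply: leq_trans (cardB (top v)); apply/subset_leq_card/subsetP => u uK.
have [->|uv] := eqVneq u v; first exact: topP.
apply: hP; last exact: vmax.
by have := Kc u; rewrite uK => /forallP/(_ v); rewrite vK uv.
Qed.

(** * Undoing the refinement steps *)

Lemma decomposition_sub (V W : finType) (e : rel V) (e' : rel W) (f : V -> W) w :
  injective f -> (forall x y, e x y -> e' (f x) (f y)) ->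
  rooted_decomposition e' w -> rooted_decomposition e w.
Proof.
move=> fI ef [N [rank [par [B [top [topP parP adjP cardB]]]]]].
exists N, rank, par, (fun n => f @^-1: B n), (top \o f); split.
- by move=> v; rewrite inE /= topP.
- by move=> v n; rewrite !inE => /parP.
- by move=> u v /ef /adjP[n [un vn]]; exists n; rewrite !inE.
move=> n; apply: leq_trans (cardB n); rewrite -(card_imset _ fI).
by apply/subset_leq_card/subsetP => _ /imsetP[x + ->]; rewrite inE.
Qed.

(** Once [None] is merged into [u], the merged vertex occupies the union of two subtrees, connected
    because some bag contains both. This removes leaves and subdivision vertices alike. *)
Lemma decomposition_contract (V : finType) (e : rel V) (e' : rel (option V)) u w :
  e' None (Some u) ->
  (forall x y, e x y -> exists x' y', [/\ odflt u x' = x, odflt u y' = y & e' x' y']) ->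
  rooted_decomposition e' w -> rooted_decomposition e w.
Proof.
move=> e'u ee' [N [rank [par [B [top [topP parP adjP cardB]]]]]].
pose C n := odflt u @: B n.
have CP x n : reflect (Some x \in B n \/ (x = u /\ None \in B n)) (x \in C n).
  apply: (iffP imsetP) => [[[y|] yB /= ->]|[xB|[-> nB]]].
  - by left.
  - by right.
  - by exists (Some x).
  - by exists None.
(* [a] is the one whose root is no deeper: [top a] is the root of the union, and a climb along the
   bags of [b] meets [a] at [top b] at the latest. *)
have [a [b [ab aB]]] : exists a b,
    ((a = None /\ b = Some u) \/ (a = Some u /\ b = None)) /\ a \in B (top b).
  have [n [n1 n2]] := adjP _ _ e'u.
  have [le|/ltnW le] := leqP (rank (top None)) (rank (top (Some u))).
    exists None, (Some u); split; first by left.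
    exact: (lower_top parP n1 n2).
  exists (Some u), None; split; first by right.
  exact: (lower_top parP n2 n1).
have uP n : reflect (a \in B n \/ b \in B n) (u \in C n).
  apply: (iffP (CP u n)); case: ab => -[-> ->]; tauto.
exists N, rank, par, C, (fun x => if x == u then top a else top (Some x)); split.
- move=> v; case: eqP => [->|_]; last by apply/CP; left.
  by apply/uP; left.
- move=> v n; case: eqP => [->|vu].
    have aP : a \in B n -> n = top a \/ (u \in C (par n) /\ rank (par n) < rank n).
      move=> /parP[|[aBn lt]]; [by left|right; split=> //].
      by apply/uP; left.
    move=> /uP[/aP //|/[dup] bn /parP[E|[bB lt]]]; first by apply: aP; rewrite E.
    by right; split=> //; apply/uP; right.
  move=> /CP[vB|[//]]; have [|[vp lt]] := parP _ _ vB; [by left|right; split=> //].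
  by apply/CP; left.
- move=> x y /ee'[x' [y' [<- <- /adjP[n [xn yn]]]]]; exists n.
  by split; apply: imset_f.
- by move=> n; apply: leq_trans (cardB n); apply: leq_imset_card.
Qed.

Lemma refinement_decomposition (G H : mgraph) w : refinement G H ->
  rooted_decomposition (@adjacent H) w -> rooted_decomposition (@adjacent G) w.
Proof.
elim=> {H} [//|H e u ue _ IH|H u _ IH|H H' _ IH [f [g [fb gb fg]]]] dec; apply: IH.
- apply: (@decomposition_contract _ _ _ u _ _ _ dec).
    by apply/set0Pn; exists None; rewrite inE.
  (* When the edge [None] is contracted, the other half [Some e] takes the place of [e]. *)
  have split_edge y : ends e = [set u; y] ->
      @adjacent (subdivide ue) None (Some y).
    move=> eE; apply/set0Pn; exists (Some e); rewrite inE /= eqxx eE.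
    by rewrite setU1K ?imset_set1 // inE (ends_neq eE).
  move=> x y /set0Pn[f]; rewrite inE => /eqP fE.
  have [fe|fe] := eqVneq f e.
    subst f; have := ue; rewrite {1}fE !inE => /orP[]/eqP xu; subst.
      by exists None, (Some y); split=> //; apply: split_edge.
    exists (Some x), None; split=> //.
    by rewrite adjacent_sym; apply: split_edge; rewrite fE setUC.
  exists (Some x), (Some y); split=> //; apply/set0Pn; exists (Some f).
  by rewrite inE /= (negPf fe) fE imsetU1 imset_set1.
- apply: (@decomposition_contract _ _ _ u _ _ _ dec).
    by apply/set0Pn; exists None; rewrite inE.
  move=> x y /set0Pn[f]; rewrite inE => /eqP fE.
  exists (Some x), (Some y); split=> //; apply/set0Pn; exists (Some f).
  by rewrite inE /= fE imsetU1 imset_set1.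
- apply: decomposition_sub dec; first exact: bij_inj fb.
  move=> x y /set0Pn[e]; rewrite inE => /eqP eE.
  by apply/set0Pn; exists (g e); rewrite inE fg eE imsetU1 imset_set1.
Qed.

(** Serves to make all multiplicities positive. [G] may be a single vertex, so the induction carries
    the alternative of at most one vertex, which an edge excludes at the end. *)
Lemma refinement_no_isolated (G H : mgraph) : connected_graph G ->
  refinement G H -> 0 < #|edge H| -> forall v : vertex H, edges_at v != set0.
Proof.
move=> cG GH.
suff: (forall v : vertex H, edges_at v != set0) \/ #|vertex H| <= 1.
  case=> // H1 /card_gt0P[e _].
  by have := max_card (mem (ends e)); rewrite (eqP (card_ends e)); lia.
elim: GH => {H} [|H e u ue _ IH|H u _ IH|H H' _ IH [f [g [fb gb fg]]]].
- case: (leqP #|vertex G| 1) => [|G1]; [by right|left=> v].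
  have [w /negPf wv] : exists w, w != v.
    apply: contrapT => no; move: G1; apply/negP; rewrite -leqNgt.
    apply/card_le1_eqP => x y _ _.
    have all_v z : z = v.
      by apply/eqP; apply: contrapT => /negP zv; apply: no; exists z.
    by rewrite (all_v x) (all_v y).
  have /andP[_ /forallP/(_ v)/forallP/(_ w)/connectP[[|x p] /= vp wE]] := cG.
    by rewrite wE eqxx in wv.
  case/andP: vp => /set0Pn[e]; rewrite inE => /eqP eE _.
  by apply/set0Pn; exists e; rewrite inE eE set21.
- case: IH => [noH|H1]; last first.
    by have := max_card (mem (ends e)); rewrite (eqP (card_ends e)); lia.
  left=> -[v|]; last by apply/set0Pn; exists None; rewrite !inE.
  have /set0Pn[f] := noH v; rewrite inE => vf; apply/set0Pn.
  have [fe|fe] := eqVneq f e; last first.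
    by exists (Some f); rewrite inE /= (negPf fe) imset_f.
  have [->|vu] := eqVneq v u; first by exists None; rewrite inE /= !inE eqxx orbT.
  exists (Some e); rewrite inE /= eqxx; apply/setU1P; right; apply: imset_f.
  by rewrite !inE vu -fe.
- left=> -[v|]; last by apply/set0Pn; exists None; rewrite !inE.
  have [->|vu] := eqVneq v u.
    by apply/set0Pn; exists None; rewrite inE /= !inE eqxx orbT.
  case: IH => [/(_ v)/set0Pn[f]|/card_le1_eqP H1].
    by rewrite inE => vf; apply/set0Pn; exists (Some f); rewrite inE imset_f.
  by rewrite (H1 v u) ?eqxx in vu.
- case: IH => [noH|H1]; [left=> v|right].
    have [f' fK f'K] := fb; have /set0Pn[e] := noH (f' v); rewrite inE => ve.
    by apply/set0Pn; exists (g e); rewrite inE fg -(f'K v) imset_f.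
  by rewrite -(bij_eq_card fb).
Qed.

(** * Decomposing the source of a harmonic homomorphism *)

Section Harmonic.
Variables (H T : mgraph) (phi : indexed_harmonic H T).

Lemma hom_ends f u v : ends f = [set u; v] ->
  ends (hom_edge phi f) = [set hom_vertex phi u; hom_vertex phi v].
Proof.
move=> fE; apply/eqP; have := @hom_edges_between _ _ phi u v f.
by rewrite !inE fE eqxx; apply.
Qed.

Lemma hom_vertex_inj_ends f u v : u \in ends f -> v \in ends f ->
  hom_vertex phi u = hom_vertex phi v -> u = v.
Proof.
move=> uf; have [w fE] := ends_other uf; rewrite fE !inE => /orP[]/eqP-> //.
by move=> E; have := ends_neq (hom_ends fE); rewrite E eqxx.
Qed.

(** The two ends of an edge have distinct images, so choosing for each vertex of [A] an incident
    edge in [F] is injective. *)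
Lemma leq_card_edges_over (A : {set vertex H}) (F : {set edge H}) c :
  (forall v, v \in A -> hom_vertex phi v = c /\ exists2 f, f \in F & v \in ends f) ->
  #|A| <= #|F|.
Proof.
move=> AF; have [->|/set0Pn[v0 v0A]] := eqVneq A set0; first by rewrite cards0.
have [_ [f0 _ _]] := AF v0 v0A.
have /choice[g gP] v : exists f, v \in A -> f \in F /\ v \in ends f.
  have [vA|vA] := boolP (v \in A); last by exists f0.
  by have [_ [f fF vf]] := AF v vA; exists f.
rewrite -(@card_in_imset _ _ g A).
  by apply/subset_leq_card/subsetP => _ /imsetP[v vA ->]; case: (gP v vA).
move=> u v uA vA E; have [_ uf] := gP u uA; have [_ vf] := gP v vA.
rewrite E in uf; apply: (hom_vertex_inj_ends uf vf).
by rewrite (proj1 (AF u uA)) (proj1 (AF v vA)).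
Qed.

Lemma hom_mult_gt0 v : edges_at v != set0 -> 0 < hom_mult phi v.
Proof.
case/set0Pn=> f; rewrite inE => vf; have [w fE] := ends_other vf.
rewrite (@hom_harmonic _ _ phi v (hom_edge phi f)).
  rewrite (bigD1 f) ?inE ?vf ?eqxx //=.
  by apply: leq_trans (hom_index_gt0 phi f) (leq_addr _ _).
by rewrite inE (hom_ends fE) set21.
Qed.

End Harmonic.

(* The fibre over a vertex t of the tree is turned into the fibre over its
   parent along a chain of nodes (t, 0), ..., (t, n): at step i the i-th edge of
   H trades its end over t for its end over the parent. *)
Lemma harmonic_decomposition (H T : mgraph) (phi : indexed_harmonic H T) d :
  ~ has_cycle T -> (forall v : vertex H, edges_at v != set0) ->
  has_degree phi d -> rooted_decomposition (@adjacent H) d.+1.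
Proof.
move=> acT noI [degE degV].
have [child [par [rk [cI cE]]]] := forest_rooting acT.
(* Numbers start at 1, so that no edge has been traded at step 0. *)
pose n := #|edge H|; pose q (f : edge H) := (enum_rank f : nat).+1.
pose pv := hom_vertex phi; pose pe := hom_edge phi.
have qn f : q f <= n := ltn_ord (enum_rank f).
(* The step up to which [v] is kept: its last edge towards the parent fibre, or 0 when it has
   none. *)
pose M v := \max_(f | (v \in ends f) && (child (pe f) == pv v)) q f.
(* [B1] holds the vertices over [t] not yet dropped, [B2] those already introduced over the parent;
   the edge being traded has both ends in the bag. *)
pose B1 (p : vertex T * nat) := [set v | (pv v == p.1) && (p.2 <= M v)].
pose B2 (p : vertex T * nat) := [set v | (pv v == par p.1) &&
  [exists f, [&& v \in ends f, child (pe f) == p.1 & q f <= p.2]]].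
(* The rank is lexicographic, as [n - p.2] is less than [n.+1]; it falls along each chain and on
   passing to the parent. *)
exists (vertex T * nat)%type, (fun p => rk p.1 * n.+1 + (n - p.2)),
  (fun p => if p.2 < n then (p.1, p.2.+1) else (par p.1, 0)),
  (fun p => B1 p :|: B2 p), (fun v => (pv v, M v)); split.
- by move=> v; rewrite !inE /= eqxx leqnn.
- move=> v [t i]; rewrite !inE /= => /orP[/andP[/eqP vt]|/andP[/eqP vt /existsP[f]]].
    have Mn : M v <= n by apply/bigmax_leqP.
    rewrite leq_eqVlt => /orP[/eqP->|iM]; first by left; rewrite vt.
    right; have iN : i < n by apply: leq_trans Mn.
    by rewrite iN /= vt eqxx iM; split=> //; lia.
  move=> /and3P[vf /eqP fc qi]; right.
  have [_] := cE (pe f); rewrite fc => rkt.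
  case: ltnP => iN; rewrite /= vt eqxx /=; split=> //.
  - by apply/orP; right; apply/existsP; exists f; rewrite vf fc eqxx leqW.
  - by lia.
  - by have : (rk (par t)).+1 * n.+1 <= rk t * n.+1; [rewrite leq_mul2r rkt orbT|lia].
- have bag f u v : ends f = [set u; v] -> pv u = child (pe f) ->
      pv v = par (child (pe f)) ->
      exists p, u \in B1 p :|: B2 p /\ v \in B1 p :|: B2 p.
    move=> fE uc vp; exists (child (pe f), q f); split; rewrite !inE /=.
      rewrite uc eqxx /=; apply/orP; left; rewrite /M.
      by apply: (@leq_bigmax_cond _ _ q); rewrite fE set21 -uc eqxx.
    rewrite vp eqxx; apply/orP; right; apply/existsP; exists f.
    by rewrite fE set22 eqxx leqnn.
  move=> u v /set0Pn[f]; rewrite inE => /eqP fE.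
  have [cEf _] := cE (pe f).
  have [[uc vp]|[up vc]] := ends_common (hom_ends phi fE) cEf.
    exact: bag fE uc vp.
  have [|p [vB uB]] := bag f v u _ vc up; first by rewrite fE setUC.
  by exists p.
move=> [t i]; apply: leq_trans (leq_card_setU _ _) _.
pose F := [set f | child (pe f) == t].
(* As [child] is injective, [F] is empty or the fibre of one tree edge, where indices of at least 1
   sum to [d]. *)
have cardF : #|F| <= d.
  have [F0|/set0Pn[f0]] := eqVneq F set0; first by rewrite F0 cards0.
  rewrite inE => /eqP f0c; rewrite (degE (pe f0)) -sum1_card.
  rewrite (eq_bigl (fun f => pe f == pe f0)).
    by apply: leq_sum => f _; apply: hom_index_gt0.
  by move=> f; rewrite inE -f0c (inj_eq cI).
(* At step 0 the bag is the whole fibre over [t], whose vertices may have no edge in [F], for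
   instance over a root; it is counted by multiplicities. *)
have [->|i0] := posnP i.
  have -> : B2 (t, 0) = set0.
    apply/setP => v; rewrite !inE; apply/negP => /andP[_ /existsP[f]].
    by rewrite ltn0 !andbF.
  rewrite cards0 addn0; apply: leqW; rewrite (degV t) -sum1_card.
  rewrite (eq_bigl (fun v => pv v == t)); last by move=> v; rewrite !inE andbT.
  by apply: leq_sum => v _; apply: hom_mult_gt0.
(* Since [0 < i <= M v], the maximum is not the default 0 and is attained by an edge in [F]. *)
have c1 : #|B1 (t, i)| <= #|F :&: [set f | i <= q f]|.
  apply: (@leq_card_edges_over _ _ phi _ _ t) => v; rewrite inE /=.
  move=> /andP[/eqP vt iM]; split=> //; apply: contrapT => no.
  have : M v <= i.-1; last by lia.
  apply/bigmax_leqP => f /andP[vf /eqP fc]; rewrite leqNgt; apply/negP => lt.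
  by apply: no; exists f; rewrite // !inE fc vt eqxx /=; lia.
have c2 : #|B2 (t, i)| <= #|F :&: [set f | q f <= i]|.
  apply: (@leq_card_edges_over _ _ phi _ _ (par t)) => v; rewrite inE /=.
  move=> /andP[/eqP vt /existsP[f /and3P[vf fc qi]]]; split=> //.
  by exists f; rewrite // !inE fc.
(* The two edge sets lie in [F] and share at most the edge numbered [i], whence the extra 1. *)
apply: leq_trans (leq_add c1 c2) _; rewrite -cardsUI -setIUr -setIIr -addn1.
apply: leq_add; first by apply: leq_trans cardF; rewrite subset_leq_card ?subsetIl.
apply/card_le1_eqP => f g; rewrite !inE -!eqn_leq.
move=> /andP[_ /eqP fi] /andP[_ /eqP gi].
by apply/enum_rank_inj/val_inj/succn_inj; apply: etrans (esym gi) fi.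
Qed.

Theorem mainTheorem7 (G : mgraph) (hG : connected_graph G) :
  ((sgon hG)%:Z >= treewidth G)%R.
Proof.
rewrite /sgon /treewidth.
case: (ex_minnP (sgon_attained_ex hG)) => d /asboolP[H [T [phi [[GH H0] [[cT acT] T0] dphi]]]] _.
have dec := harmonic_decomposition acT (refinement_no_isolated hG GH H0) dphi.
have [h hext hd] := decomposition_chordal (refinement_decomposition GH dec).
(* The minimum [w] is at most the clique number of [h], hence at most [d.+1]; the offset -1 absorbs
   the extra 1. *)
case: ex_minnP => w _ /(_ (clique_number h)).
have -> : `[< tw_attained G (clique_number h) >] by apply/asboolP; exists h.
by move=> /(_ isT); lia.
Qed.
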